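(* Every forest configuration is liftable over $\mathbb{C}$.
   Context: A point-line configuration is a triple $(\mathcal{P},\mathcal{L},\mathcal{I})$ with a finite set of points, a set of lines, and incidences $\mathcal{I}\subseteq\mathcal{P}\times\mathcal{L}$; a line is identified with the set of points incident to it. It is linear if any two points lie on at most one common line and every line contains at least two points; configurations here are linear. Given a total order $p_1<\dots<p_n$ on $\mathcal{P}$, the graph $G_{\mathcal{C}}$ of $\mathcal{C}=(\mathcal{P},\mathcal{L},\mathcal{I})$ has vertex set $\mathcal{P}$ and an edge $p_ip_j$ ($p_i<p_j$) whenever $p_i,p_j\in\ell$ for some line $\ell$ and no $p_k\in\ell$ satisfies $p_i<p_k<p_j$. $\mathcal{C}$ is a forest configuration if $G_{\mathcal{C}}$ is a forest (this does not depend on the chosen order). A non-degenerate realisation of a linear configuration $\mathcal{C}$ with $n$ points is an $n$-tuple of points of $\mathbb{P}^2_{\mathbb{C}}$ together with a bijection with the points of $\mathcal{C}$ such that (non-)collinear points in $\mathcal{C}$ correspond to (non-)collinear points in $\mathbb{P}^2_{\mathbb{C}}$. $\mathcal{C}$ is liftable over $\mathbb{C}$ if every $n$-tuple of distinct collinear points of $\mathbb{P}^2_{\mathbb{C}}$ (labelled by the points of $\mathcal{C}$) is the image, under projection from a point outside their line onto that line, of a non-degenerate realisation of $\mathcal{C}$. *)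

(* Defs.v *)
From mathcomp Require Import all_boot all_order all_algebra.

Set Implicit Arguments.
Unset Strict Implicit.
Unset Printing Implicit Defensive.

Local Open Scope ring_scope.

(* A line is identified with the set of points incident to it, so incidence
   is membership. *)
Record configuration := Configuration {
  point :> finType;
  lines : {set {set point}}
}.

Section Configurations.
Variable C : configuration.

Definition linear_config : Prop :=
  (forall p q : C, p != q ->
     forall l m : {set C}, l \in lines C -> m \in lines C ->
       p \in l -> q \in l -> p \in m -> q \in m -> l = m) /\
  (forall l : {set C}, l \in lines C -> (2 <= #|l|)%N).

Definition total_order (le : rel C) : Prop :=
  [/\ total le, antisymmetric le & transitive le].

Section Graph.
Variable le : rel C.

Let lt (p q : C) : bool := (p != q) && le p q.

(* [p] and [q] are consecutive, in this order, on some line. *)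
Definition consecutive (p q : C) : bool :=
  lt p q && [exists l in lines C,
    [&& p \in l, q \in l & [forall k in l, ~~ (lt p k && lt k q)]]].

Definition config_graph : rel C :=
  fun p q => consecutive p q || consecutive q p.

End Graph.

(* [e] is meant to be symmetric and irreflexive: its cycles, in the sense of
   graph theory, are then the [ucycle]s with at least three vertices. *)
Definition is_forest (e : rel C) : Prop :=
  forall c : seq C, ucycle e c -> (size c <= 2)%N.

(* For a linear configuration this does not depend on the order, so asking for
   some order or for all of them amounts to the same. *)
Definition forest_config : Prop :=
  exists le : rel C, total_order le /\ is_forest (config_graph le).

Definition config_collinear (S : {set C}) : Prop :=
  exists2 l : {set C}, l \in lines C & S \subset l.

End Configurations.

Section ProjectivePlane.
Variable F : fieldType.

(* Points and lines of the projective plane over [F] are the subspaces of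
   [F^3] of dimension 1 and 2; incidence is inclusion. *)
Definition proj_point := {p : {vspace 'rV[F]_3} | \dim p == 1%N}.
Definition proj_line := {M : {vspace 'rV[F]_3} | \dim M == 2%N}.

Definition on_line (p : proj_point) (M : proj_line) : bool :=
  (val p <= val M)%VS.

(* [y] is the image of [p] under the projection from [o] onto [M], that is,
   the intersection of [M] with the line through [o] and [p]. *)
Definition projects_to (o : proj_point) (M : proj_line)
    (p y : proj_point) : Prop :=
  p <> o /\ val y = ((val o + val p) :&: val M)%VS.

Variable C : configuration.

Definition collinear_image (f : C -> proj_point) (S : {set C}) : Prop :=
  exists M : proj_line, forall p, p \in S -> on_line (f p) M.

(* Collinearity is compared on sets of at least three points only: two points
   of the plane are always collinear, whereas two points of [C] need not lie on
   a common line of [C]. *)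
Definition nondegenerate_realisation (f : C -> proj_point) : Prop :=
  injective f /\
  forall S : {set C}, (3 <= #|S|)%N ->
    (config_collinear S <-> collinear_image f S).

Definition liftable : Prop :=
  forall (x : C -> proj_point) (M : proj_line),
    injective x -> (forall p, on_line (x p) M) ->
    exists (o : proj_point) (f : C -> proj_point),
      [/\ ~~ on_line o M,
          nondegenerate_realisation f
        & forall p, projects_to o M (f p) (x p)].

End ProjectivePlane.

(* Main.v *)
(** In an affine chart the given collinear points have distinct coordinates
    [t p], and lifting them amounts to choosing heights [h p]: the realisation
    is [(t p, h p)], projected from the vertical point at infinity. Pruning
    leaves of the graph shows that every nonempty set of lines of a forest
    configuration contains a line meeting all the others in at most one point
    [a]. Adding the lines in the reverse order, and starting from the parabola
    [h p = t p ^ 2], which has no three points aligned, we move the points of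
    the new line onto a line through [(t a, h a)] of generic slope: this only
    moves points lying on no other line added so far, and creates no other
    alignment. *)

Require Import Defs.
From mathcomp Require Import all_boot all_order all_algebra.
From mathcomp Require Import reals complex.
From mathcomp Require Import ring zify.

Set Implicit Arguments.
Unset Strict Implicit.
Unset Printing Implicit Defensive.

Import Order.TTheory GRing.Theory Num.Theory.

(** * Leaves of finite forests *)

Lemma acyclic_has_leaf (T : finType) (e : rel T) (A : {set T}) :
  symmetric e -> irreflexive e ->
  (forall c : seq T, ucycle e c -> (size c <= 2)%N) ->
  (forall p q, e p q -> q \in A) -> A != set0 ->
  exists2 p, p \in A & forall q r, e p q -> e p r -> q = r.
Proof.
move=> e_sym e_irr e_forest eA /set0Pn[p0 Ap0].
have [/exists_inP[p Ap /'forall_forallP p_leaf]|no_leaf] :=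
    boolP [exists p in A, [forall q, forall r, e p q ==> e p r ==> (q == r)]].
  by exists p => // q r epq epr; apply/eqP; move: (p_leaf q r); rewrite epq epr.
have branch p y : p \in A -> exists2 z, e p z & z != y.
  move=> Ap; have /negP := no_leaf => no.
  have [/existsP[z /andP[]]|/existsPn noz] := boolP [exists z, e p z && (z != y)].
    by exists z.
  case: no; apply/exists_inP; exists p => //; apply/forallP => q; apply/forallP => r.
  apply/implyP => epq; apply/implyP => epr.
  move: (noz q) (noz r); rewrite epq epr /= !negbK.
  by move=> /eqP-> /eqP->.
(* Without a leaf, simple paths would grow at their head forever: the head has a neighbour other
   than the next vertex, and if that neighbour were already on the path it would close a cycle with
   at least three vertices. *)
have long n : exists x s, [/\ x \in A, path e x s, uniq (x :: s) & size s = n].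
  elim: n => [|n [x [s [Ax exs us sz]]]]; first by exists p0, [::].
  (* On a one-vertex path the default [x] of [head] only demands [z != x]. *)
  have [z exz zy] := branch x (head x s) Ax.
  have [zs|zNs] := boolP (z \in x :: s); last first.
    exists z, (x :: s); split; rewrite /= ?sz //.
    - exact: eA exz.
    - by rewrite e_sym exz.
    - by rewrite zNs.
  move: zs; rewrite inE => /orP[/eqP zx|]; first by rewrite zx e_irr in exz.
  case: s exs us sz zy => // y s exs us sz zy; rewrite inE.
  rewrite /= in exs us zy; rewrite (negPf zy) /= => zs; case/splitPr: zs exs us sz => s1 s2 exs us sz.
  have /e_forest : ucycle e (x :: y :: rcons s1 z).
    apply/andP; split.
      rewrite (cycle_path x) /= last_rcons e_sym exz /=.
      by move: exs; rewrite -cat_rcons cat_path => /andP[-> /andP[]].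
    move: us; rewrite -cat_rcons -!cat_cons -[(x \notin _) && _]/(uniq (x :: y :: _)).
    by rewrite -!cat_cons cat_uniq => /andP[].
  by rewrite /= size_rcons.
have [x [s [_ _ us sz]]] := long #|T|.
by have := max_card (mem (x :: s)); rewrite (card_uniqP us) /= sz ltnn.
Qed.

(** * Pruning order on the points of a forest configuration *)

Section Elimination.
Variables (C : configuration) (le : rel C).
Hypotheses (C_linear : linear_config C) (le_total : total_order le).

Let before (p q : C) : bool := (p != q) && le p q.

(** Lines are replaced by their traces on [A], which differs from an induced subgraph: deleting a
    point makes its two neighbours on a line adjacent. *)
Definition consecutive_in (A : {set C}) (p q : C) : bool :=
  before p q && [exists l in lines C,
    [&& p \in l :&: A, q \in l :&: A & [forall k in l :&: A, ~~ (before p k && before k q)]]].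

Definition graph_in (A : {set C}) : rel C :=
  fun p q => consecutive_in A p q || consecutive_in A q p.

Lemma graph_inT : graph_in [set: C] =2 config_graph le.
Proof.
have E p q : consecutive_in [set: C] p q = consecutive le p q.
  rewrite /consecutive_in /consecutive; congr andb.
  by apply: eq_existsb => l; rewrite !setIT.
by move=> p q; rewrite /graph_in !E.
Qed.

Lemma before_irr p : before p p = false. Proof. by rewrite /before eqxx. Qed.

Lemma before_trans : transitive before.
Proof.
case: le_total => _ anti trans q p r /andP[pq lepq] /andP[qr leqr].
rewrite /before (trans _ _ _ lepq leqr) andbT; apply: contraNneq pq => pr.
by apply/eqP/anti; rewrite lepq pr leqr.
Qed.

Lemma before_total p q : p != q -> before p q || before q p.
Proof. by case: le_total => tot _ _ pq; rewrite /before (eq_sym q) pq /=; apply: tot. Qed.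

Lemma graph_in_sym A : symmetric (graph_in A).
Proof. by move=> p q; rewrite /graph_in orbC. Qed.

Lemma graph_in_irr A : irreflexive (graph_in A).
Proof. by move=> p; rewrite /graph_in /consecutive_in before_irr. Qed.

Lemma graph_in_sub A p q : graph_in A p q -> q \in A.
Proof.
by case/orP => /andP[_ /exists_inP[l _ /and3P[]]]; rewrite !inE => /andP[_ ?] /andP[_ ?].
Qed.

Lemma neighbour_on_line A l p q :
  l \in lines C -> p \in l :&: A -> q \in l :&: A -> p != q ->
  exists2 r, r \in l & graph_in A p r.
Proof.
move=> Ll pl ql pq.
pose btw (x y k : C) := (before x k && before k y).
(* Induction on the number of points strictly between [x] and [y]. Both ends are treated because [p]
   may come before or after [q]. *)
have gen (x y : C) n : #|[set k in l :&: A | btw x y k]| = n ->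
    x \in l :&: A -> y \in l :&: A -> before x y ->
    (exists2 r, r \in l & consecutive_in A x r) /\
    (exists2 r, r \in l & consecutive_in A r y).
  elim/ltn_ind: n x y => n IH x y nE xl yl ltxy.
  have [|/exists_inPn nobtw] := boolP [exists k in l :&: A, btw x y k].
    move=> /exists_inP[k kl /andP[xk ky]]; split.
      apply: (IH _ _ x k erefl _ kl xk).1 => //; rewrite -nE; apply: proper_card.
      apply/properP; split.
        apply/subsetP => z; rewrite !inE => /and3P[-> xz zk].
        by rewrite /btw xz (before_trans zk ky).
      by exists k; rewrite inE kl /btw ?xk ?ky //= before_irr.
    apply: (IH _ _ k y erefl kl yl ky).2; rewrite -nE; apply: proper_card.
    apply/properP; split.
      apply/subsetP => z; rewrite !inE => /and3P[-> kz zy].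
      by rewrite /btw zy (before_trans xk kz).
    by exists k; rewrite inE kl /btw ?xk ?ky //= before_irr.
  have xy : consecutive_in A x y.
    rewrite /consecutive_in ltxy; apply/exists_inP; exists l => //.
    by rewrite xl yl; apply/forall_inP => k /nobtw.
  by move: xl yl; rewrite !inE => /andP[xl _] /andP[yl _]; split; [exists y | exists x].
case/orP: (before_total pq) => [ltpq|ltqp].
  have [[r rl pr] _] := gen _ _ _ erefl pl ql ltpq.
  by exists r => //; rewrite /graph_in pr.
have [_ [r rl pr]] := gen _ _ _ erefl ql pl ltqp.
by exists r => //; rewrite /graph_in pr orbT.
Qed.

(** Each of the two lines gives [p] a neighbour; a leaf has only one, so the lines share two
    points. *)
Lemma graph_in_leaf_line A p l m q r :
  (forall x y, graph_in A p x -> graph_in A p y -> x = y) ->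
  l \in lines C -> m \in lines C -> p \in l -> p \in m -> p \in A ->
  q \in l :&: A -> r \in m :&: A -> p != q -> p != r -> l = m.
Proof.
move=> p_leaf Ll Lm pl pm pA ql rm pq pr.
have pl' : p \in l :&: A by rewrite inE pl.
have pm' : p \in m :&: A by rewrite inE pm.
have [x xl px] := neighbour_on_line Ll pl' ql pq.
have [y ym py] := neighbour_on_line Lm pm' rm pr.
have xy := p_leaf _ _ px py; subst y.
have px' : p != x by apply: contraTneq px => <-; rewrite graph_in_irr.
exact: C_linear.1 px' _ _ Ll Lm pl xl pm ym.
Qed.

(* A leaf is an end point of the trace on [A] of its line, so that removing it
   creates no new edge. *)
Lemma graph_in_remove_leaf A p :
  (forall x y, graph_in A p x -> graph_in A p y -> x = y) ->
  subrel (graph_in (A :\ p)) (graph_in A).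
Proof.
move=> p_leaf.
have sub q r : consecutive_in (A :\ p) q r -> consecutive_in A q r.
  move=> /andP[ltqr /exists_inP[l Ll /and3P[ql rl /forall_inP nobtw]]].
  have {nobtw} btw k : k \in l :&: A -> before q k && before k r -> k = p.
    move=> kl kqr; apply/eqP; apply: contraTT kqr => kp; apply: nobtw.
    by move: kl; rewrite !inE kp.
  have qr : q != r by case/andP: ltqr.
  have {}ql : q \in l :&: A by move: ql; rewrite !inE => /and3P[-> _ ->].
  have {}rl : r \in l :&: A by move: rl; rewrite !inE => /and3P[-> _ ->].
  rewrite /consecutive_in ltqr; apply/exists_inP; exists l => //.
  rewrite ql rl; apply/forall_inP => k kl; apply/negP => kqr.
  have kp := btw _ kl kqr; subst k; case/andP: kqr => qp pr.
  (* If [p] were between [q] and [r], both would be its neighbours: a point of the trace between [p]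
     and either of them is also between [q] and [r], hence is [p]. *)
  case/eqP: qr; apply: p_leaf; apply/orP; [right|left]; apply/andP; split => //;
    apply/exists_inP; exists l => //; rewrite ?ql ?rl kl /=; apply/forall_inP => k kl';
    apply/negP => /andP[k1 k2].
    have kp : k = p by apply: btw; rewrite // k1 (before_trans k2 pr).
    by rewrite kp before_irr in k2.
  have kp : k = p by apply: btw; rewrite // k2 (before_trans qp k1).
  by rewrite kp before_irr in k1.
by move=> q r /orP[] /sub; rewrite /graph_in => ->; rewrite ?orbT.
Qed.

(* [rk] is the order in which leaves are pruned: when [p] is pruned, at most one
   line through [p] still contains another point. *)
Lemma forest_elimination_in (A : {set C}) :
  is_forest (graph_in A) ->
  exists rk : C -> nat, {in A &, injective rk} /\
    forall p l m q r, l \in lines C -> m \in lines C ->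
      p \in l -> q \in l -> p \in m -> r \in m -> p \in A -> q \in A -> r \in A ->
      (rk p < rk q)%N -> (rk p < rk r)%N -> l = m.
Proof.
have [n nA] := ubnP #|A|; elim: n A nA => // n IH A nA A_forest.
have [->|A0] := eqVneq A set0.
  by exists (fun=> 0%N); split=> [p q|p l m q r]; rewrite inE.
have [p pA p_leaf] := acyclic_has_leaf (@graph_in_sym A) (@graph_in_irr A)
  A_forest (@graph_in_sub A) A0.
have [||rk [rk_inj rk_elim]] := IH (A :\ p).
- by move: nA; rewrite (cardsD1 p A) pA; lia.
- move=> c /andP[cc uc]; apply: A_forest; apply/andP; split => //.
  exact: sub_cycle (graph_in_remove_leaf p_leaf) _ cc.
exists (fun x => if x == p then 0%N else (rk x).+1); split.
  move=> x y xA yA; case: eqVneq => [->|xp]; case: eqVneq => [->|yp] // [].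
  by apply: rk_inj; rewrite !inE ?xp ?yp.
move=> x l m q r Ll Lm xl ql xm rm xA qA rA.
have [_ //|qp] := eqVneq q p; have [_ //|rp] := eqVneq r p.
have [xp|xp] := eqVneq x p; last first.
  by rewrite !ltnS; apply: rk_elim; rewrite // !inE ?xp ?qp ?rp.
move=> _ _; subst x.
by apply: (graph_in_leaf_line p_leaf Ll Lm xl xm pA (q := q) (r := r));
  rewrite ?inE ?ql ?rm // eq_sym.
Qed.

End Elimination.

(* [a] is the point of [l] pruned last, and [l] is the line for which this
   happens first. *)
Lemma forest_has_leaf_line (C : configuration) (L : {set {set C}}) :
  linear_config C -> forest_config C -> L \subset lines C -> L != set0 ->
  exists2 l, l \in L & exists2 a, a \in l &
    forall m p, m \in L -> m != l -> p \in l -> p \in m -> p = a.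
Proof.
move=> C_linear [le [le_total le_forest]] /subsetP LC /set0Pn[l0 Ll0].
have [|rk [rk_inj rk_elim]] := @forest_elimination_in C le C_linear le_total setT.
- move=> c /andP[cc uc]; apply: le_forest; apply/andP; split => //.
  by rewrite -(eq_cycle (@graph_inT C le)).
- pose top (l : {set C}) := \max_(p in l) rk p.
have topP l : l \in lines C -> exists2 a, a \in l & top l = rk a.
  move=> /C_linear.2 l2; have /card_gt0P[a al] : (0 < #|l|)%N by lia.
  have [b bl topE] := eq_bigmax_cond rk (A := mem l) (ltac:(by apply/card_gt0P; exists a)).
  by exists b.
case: (@arg_minnP _ l0 (mem L) top Ll0) => l Ll l_min.
have [a al topa] := topP _ (LC _ Ll).
exists l => //; exists a => // m p Lm ml pl pm.
apply/eqP; apply: contraNT ml => pa; apply/eqP.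
have lt_pa : (rk p < rk a)%N.
  rewrite ltn_neqAle -topa leq_bigmax_cond // topa andbT.
  by apply: contraNneq pa => /rk_inj->.
have [b bm topb] := topP _ (LC _ Lm).
apply: (rk_elim p m l b a); rewrite ?inE ?LC //.
by rewrite -topb; apply: leq_trans (l_min _ Lm); rewrite topa.
Qed.

(** * Heights with prescribed alignments over distinct coordinates *)

Local Open Scope ring_scope.

Lemma exists_notin_seq (F : numDomainType) (s : seq F) : exists u, u \notin s.
Proof.
have sum_ge0 r : 0 <= \sum_(b <- r) `|b| :> F by apply: sumr_ge0.
(* Were this value in [s], its own norm would be a term of the sum; cancelling it leaves 1 plus
   nonnegative terms equal to 0. *)
exists (1 + \sum_(b <- s) `|b|); apply/negP => us.
have [u u_ge0 uE] : exists2 u, 0 <= u & 1 + \sum_(b <- s) `|b| = u.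
  by eexists; last reflexivity; rewrite addr_ge0.
rewrite uE in us; move: uE; rewrite (big_rem u us) /= (ger0_norm u_ge0) => /eqP.
by rewrite addrCA -subr_eq0 addrAC subrr add0r gt_eqF // ltr_wpDr // ltr01.
Qed.

Section Heights.
Variables (F : numFieldType) (T : finType) (t : T -> F).
Hypothesis t_inj : injective t.

(** Equality of the slopes from [(t p, h p)] to the two other points, cross-multiplied; it always
    holds when two of the three points coincide. *)
Definition aligned (h : T -> F) (p q r : T) : bool :=
  (h q - h p) * (t r - t p) == (h r - h p) * (t q - t p).

Lemma alignedC12 h p q r : aligned h p q r = aligned h q p r.
Proof.
rewrite /aligned -subr_eq0 -[RHS]subr_eq0 -[RHS]oppr_eq0; congr (_ == 0); ring.
Qed.

Lemma alignedC23 h p q r : aligned h p q r = aligned h p r q.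
Proof. by rewrite /aligned eq_sym. Qed.

Definition affine_on (h : T -> F) (l : {set T}) :=
  exists c d, forall p, p \in l -> h p = c + d * t p.

(* The points of [l] are moved onto a line through [(t a, h a)]; only finitely
   many slopes create an alignment with a point outside [l]. *)
Lemma tilt_line (h : T -> F) (l : {set T}) (a : T) : a \in l ->
  exists h' : T -> F,
    [/\ affine_on h' l, forall p, (p \notin l) || (p == a) -> h' p = h p &
      forall p q r, p != q -> p != r -> q != r -> aligned h' p q r ->
        aligned h p q r \/ [/\ p \in l, q \in l & r \in l]].
Proof.
move=> al.
(* With this slope, the tilted line would pass through the point over [z]. *)
pose slope1 (z : T) := (h z - h a) / (t z - t a).
(* With this slope, [p] would be moved onto the line through the points over [q] and [r]: the inner
   quotient is the height of that line at [t p]. Zero denominators merely exclude some further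
   slopes. *)
pose slope2 (z : T * T * T) := let: (p, q, r) := z in
  ((h q * (t r - t p) - h r * (t q - t p)) / (t r - t q) - h a) / (t p - t a).
have [u] := exists_notin_seq ([seq slope1 z | z : T] ++ [seq slope2 z | z : T * T * T]).
rewrite mem_cat negb_or => /andP[/imageP u1 /imageP u2].
pose h' p := if p \in l then h a + u * (t p - t a) else h p.
have h'l p : p \in l -> h' p = h a + u * (t p - t a) by rewrite /h' => ->.
have h'h p : (p \notin l) || (p == a) -> h' p = h p.
  rewrite /h'; case: ifP => //= pl /eqP->; ring.
have sub0 x y : x != y -> t x - t y != 0.
  by apply: contraNneq => /subr0_eq/t_inj ->.
exists h'; split => //.
  by exists (h a - u * t a), u => p /h'l->; ring.
(* The points allowed to move. The cases follow the number of fresh points: with two of them, a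
   third aligned point must lie on [l]; with one, alignment is impossible; with none, nothing
   changes. *)
pose fresh p := (p \in l) && (p != a).
have two p q r : fresh p -> fresh q -> p != q -> r \notin l -> ~~ aligned h' p q r.
  move=> /andP[pl pa] /andP[ql qa] pq rl; apply/negP => /eqP.
  have ra : r != a by apply: contraNneq rl => ->.
  rewrite (h'l p) // (h'l q) // (h'h r) ?rl // => E; apply: u1; exists r; rewrite // /slope1.
  have {}ra := sub0 _ _ ra; apply/(mulIf ra); rewrite mulfVK //.
  have qp : t q - t p != 0 by rewrite sub0 // eq_sym.
  apply/(mulIf qp); move: E => /eqP; rewrite -subr_eq0 => /eqP E.
  apply/eqP; rewrite -subr_eq0 -E; apply/eqP; ring.
have one p q r : fresh p -> ~~ fresh q -> ~~ fresh r -> q != r ->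
    ~~ aligned h' p q r.
  move=> /andP[pl pa] qf rf qr; apply/negP => /eqP.
  have nf z : ~~ fresh z -> (z \notin l) || (z == a) by rewrite negb_and negbK.
  rewrite (h'l p) // (h'h q) ?nf // (h'h r) ?nf // => E; apply: u2; exists (p, q, r) => //=.
  have rq : t r - t q != 0 by rewrite sub0 // eq_sym.
  have {}pa := sub0 _ _ pa.
  apply/(mulIf pa); rewrite mulfVK //; apply/(mulIf rq); rewrite mulrBl mulfVK //.
  apply/eqP; rewrite -subr_eq0; move/eqP: E; rewrite -subr_eq0.
  by rewrite -oppr_eq0 => /eqP E; rewrite -E; apply/eqP; ring.
have zero p q r : ~~ fresh p -> ~~ fresh q -> ~~ fresh r ->
    aligned h' p q r = aligned h p q r.
  rewrite /fresh !negb_and !negbK => pf qf rf.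
  by rewrite /aligned (h'h _ pf) (h'h _ qf) (h'h _ rf).
have third p q r : fresh p -> fresh q -> p != q -> ~~ fresh r -> aligned h' p q r -> r = a.
  move=> pf qf pq rf; apply: contraTeq => ra; apply: two => //.
  by move: rf; rewrite /fresh ra andbT.
have fl p : fresh p -> p \in l by case/andP.
move=> p q r pq pr qr; case: (boolP (fresh p)) (boolP (fresh q)) (boolP (fresh r))
  => [pf|pf] [qf|qf] [rf|rf] A.
- by right; split; apply: fl.
- by right; have -> := third _ _ _ pf qf pq rf A; split=> //; apply: fl.
- rewrite alignedC23 in A.
  by right; have -> := third _ _ _ pf rf pr qf A; split=> //; apply: fl.
- by move: A; rewrite (negPf (one _ _ _ pf qf rf qr)).
- rewrite alignedC12 alignedC23 in A.
  by right; have -> := third _ _ _ qf rf qr pf A; split=> //; apply: fl.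
- by move: A; rewrite alignedC12 (negPf (one _ _ _ qf pf rf pr)).
- by move: A; rewrite alignedC23 alignedC12 (negPf (one _ _ _ rf pf qf pq)).
- by left; rewrite -zero.
Qed.

End Heights.

Lemma exists_heights (F : numFieldType) (C : configuration) (t : C -> F)
    (L : {set {set C}}) :
  injective t -> linear_config C -> forest_config C -> L \subset lines C ->
  exists h : C -> F, (forall l, l \in L -> affine_on t h l) /\
    forall p q r, p != q -> p != r -> q != r -> aligned t h p q r ->
      exists2 l, l \in L & [/\ p \in l, q \in l & r \in l].
Proof.
move=> t_inj C_linear C_forest; have [n] := ubnP #|L|.
elim: n L => // n IH L Ln LC; have [->|L0] := eqVneq L set0.
  exists (fun p => t p ^+ 2); split=> [l|p q r pq pr qr]; first by rewrite inE.
  rewrite /aligned -subr_eq0.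
  (* A Vandermonde determinant, nonzero at distinct coordinates. *)
  have -> : (t q ^+ 2 - t p ^+ 2) * (t r - t p) - (t r ^+ 2 - t p ^+ 2) * (t q - t p) =
    (t q - t p) * (t r - t p) * (t q - t r) by ring.
  by rewrite !mulf_eq0 !subr_eq0 !(inj_eq t_inj) (eq_sym q p) (eq_sym r p)
    (negPf pq) (negPf pr) (negPf qr).
have [l Ll [a al la]] := forest_has_leaf_line C_linear C_forest LC L0.
have [||h [h_aff h_al]] := IH (L :\ l).
- by move: Ln; rewrite (cardsD1 l L) Ll; lia.
- exact: subset_trans (subD1set _ _) LC.
have [h' [h'_aff h'h h'_al]] := tilt_line t_inj h al.
exists h'; split.
  move=> m Lm; have [->//|ml] := eqVneq m l.
  have [|c [d hcd]] := h_aff m; first by rewrite !inE ml.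
  exists c, d => p pm; rewrite h'h ?hcd //.
  by case: (boolP (p \in l)) => //= pl; rewrite (la m p).
move=> p q r pq pr qr /(h'_al _ _ _ pq pr qr)[A|]; last by exists l.
have [m] := h_al _ _ _ pq pr qr A.
by rewrite !inE => /andP[_ Lm] ?; exists m.
Qed.

(** * From heights to realisations in the projective plane *)

Section Projective.
Variable F : numFieldType.

Lemma vline_of_dim1 (vT : vectType F) (U : {vspace vT}) :
  \dim U = 1%N -> exists2 v, v != 0 & U = <[v]>%VS.
Proof.
move=> U1; have U0 : U != 0%VS by rewrite -dimv_eq0 U1.
exists (vpick U); first by rewrite vpick0.
by apply/eqP; rewrite eq_sym eqEdim -memvE memv_pick U1 dim_vline vpick0 U0.
Qed.

Lemma vplane_of_dim2 (vT : vectType F) (U : {vspace vT}) :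
  \dim U = 2%N -> exists u v, U = (<[u]> + <[v]>)%VS.
Proof.
move=> U2; have /andP[/eqP UE _] := vbasisP U.
have [s sU s2] : exists2 s, <<s>>%VS = U & size s = 2%N.
  by exists (vbasis U); rewrite ?size_tuple.
case: s sU s2 => [|u [|v []]] //; rewrite span_cons span_seq1 => <- _.
by exists u, v.
Qed.

(* The second basis vector is chosen to represent none of the points [x p], so
   that these have a finite affine coordinate. *)
Lemma affine_coordinates (T : finType) (V : {vspace 'rV[F]_3}) (x : T -> proj_point F) :
  \dim V = 2%N -> (forall p, val (x p) <= V)%VS ->
  exists b e (t : T -> F), [/\ b \in V, e \in V, (V <= <[b]> + <[e]>)%VS &
    forall p, val (x p) = <[b + t p *: e]>%VS].
Proof.
move=> V2 xV; have [b [b1 VE]] := vplane_of_dim2 V2.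
have bV : b \in V by rewrite VE (subvP (addvSl _ _)) ?memv_line.
have b1V : b1 \in V by rewrite VE (subvP (addvSr _ _)) ?memv_line.
have coef p : exists c : F * F, (c != 0) && (val (x p) == <[c.1 *: b + c.2 *: b1]>%VS).
  have [v v0 vE] := vline_of_dim1 (eqP (valP (x p))).
  have : v \in V by rewrite memvE -vE xV.
  rewrite VE => /memv_addP[_ /vlineP[y ->] [_ /vlineP[z ->] vyz]].
  exists (y, z); rewrite -vyz vE eqxx andbT; apply: contraNneq v0 => -[y0 z0].
  by rewrite vyz y0 z0 !scale0r addr0.
pose c p := xchoose (coef p).
(* In the basis [b], [b1 + u *: b], the vector [y *: b + z *: b1] has first coordinate [y - u * z];
   avoiding the ratios [y / z] keeps it nonzero. *)
have [u] := exists_notin_seq [seq (c p).1 / (c p).2 | p : T].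
move=> /imageP u_notin.
have cu p : (c p).1 - u * (c p).2 != 0.
  have [c2|c2] := eqVneq (c p).2 0.
    have /andP[+ _] := xchooseP (coef p); rewrite -/(c p); apply: contraNneq.
    by move: c2; case: (c p) => y z /= ->; rewrite mulr0 subr0 => ->.
  apply/negP; rewrite subr_eq0 => /eqP E; apply: u_notin; exists p => //.
  by rewrite E mulfK.
exists b, (b1 + u *: b), (fun p => (c p).2 / ((c p).1 - u * (c p).2)); split => //.
- by rewrite rpredD // rpredZ.
- have bS : b \in (<[b]> + <[b1 + u *: b]>)%VS by rewrite (subvP (addvSl _ _)) ?memv_line.
  rewrite {1}VE subv_add -!memvE bS -(rpredDr b1 (rpredZ u bS)).
  by rewrite (subvP (addvSr _ _)) ?memv_line.
move=> p; have /andP[_ /eqP ->] := xchooseP (coef p); rewrite -/(c p).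
set y := (c p).1; set z := (c p).2; have {}cu := cu p; rewrite -/y -/z in cu *.
have -> : y *: b + z *: b1 = (y - u * z) *: (b + (z / (y - u * z)) *: (b1 + u *: b)).
  rewrite [RHS]scalerDr scalerA (mulrC (y - _)) divfK // scalerBl scalerDr scalerA.
  by rewrite (mulrC u) addrACA addNr addr0.
apply/eqP; rewrite eqEsubv -!memvE; apply/andP; split; first by rewrite memvZ ?memv_line.
by apply/vlineP; exists (y - u * z)^-1; rewrite scalerA mulVf // scale1r.
Qed.

(** A vector [w] outside [V] spans the centre of projection, and [p] lifts to the span of
    [v p + h p *: w]; alignment over [t] becomes linear dependence of the lifted vectors. *)
Lemma liftable_of_heights (C : configuration) :
  linear_config C ->
  (forall t : C -> F, injective t -> exists h : C -> F,
     (forall l, l \in lines C -> affine_on t h l) /\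
     forall p q r, p != q -> p != r -> q != r -> aligned t h p q r ->
       exists2 l, l \in lines C & [/\ p \in l, q \in l & r \in l]) ->
  liftable F C.
Proof.
move=> C_linear heights x M x_inj xM.
set V := val M; have V2 : \dim V = 2%N by apply/eqP/(valP M).
have [b [e [t [bV eV Vbe xE]]]] := affine_coordinates V2 xM.
have t_inj : injective t.
  by move=> p q tpq; apply/x_inj/val_inj; rewrite /= !xE tpq.
have [h [h_aff h_al]] := heights t t_inj.
have [w _ wV] : exists2 w, w \in fullv & w \notin V.
  by apply/subvPn; apply: contra_eqN V2 => /dimvS; rewrite dimvf /dim /= mul1n => V3; lia.
have Vw U : (V <= U)%VS -> w \in U -> (3 <= \dim U)%N.
  move=> VU wU; suff: (\dim V < \dim U)%N by rewrite V2.
  rewrite ltn_neqAle dimvS // (dimv_leqif_sup VU) andbT.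
  by apply: contra wV => /subvP; apply.
have wV0 k : k *: w \in V -> k = 0.
  by rewrite rpredZeq (negPf wV) orbF => /eqP.
pose v p := b + t p *: e.
have vV p : v p \in V by rewrite rpredD ?rpredZ.
have v0 p : v p != 0.
  by have := valP (x p); rewrite /= xE dim_vline -/(v p); case: (v p != 0).
have g0 p : v p + h p *: w != 0.
  apply: contraNneq (v0 p) => E; suff h0 : h p = 0 by rewrite -E h0 scale0r addr0.
  by apply: wV0; rewrite -(addKr (v p) (h p *: w)) E addr0 rpredN vV.
have dim1 (z : 'rV[F]_3) : z != 0 -> \dim <[z]> == 1%N by rewrite dim_vline => ->.
have w0 : w != 0 by apply: contraNneq wV => ->; rewrite mem0v.
pose o : proj_point F := exist _ <[w]>%VS (dim1 _ w0).
pose f p : proj_point F := exist _ <[v p + h p *: w]>%VS (dim1 _ (g0 p)).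
have proj p : projects_to o M (f p) (x p).
  split.
    move=> /(congr1 val) /= E; have : v p + h p *: w \in <[w]>%VS by rewrite -E memv_line.
    case/vlineP => k kE; have vE : v p = (k - h p) *: w by rewrite scalerBl -kE addrK.
    have := vV p; rewrite vE => /wV0 k0.
    by have := v0 p; rewrite vE k0 scale0r eqxx.
  rewrite xE -/(v p); apply/eqP; rewrite eqEsubv -memvE memv_cap vV andbT; apply/andP; split.
    rewrite -(addrK (h p *: w) (v p)) addrC memv_add ?memv_line // rpredN rpredZ //.
    exact: memv_line.
  apply/subvP => z; rewrite memv_cap => /andP[/memv_addP[_ /vlineP[k ->] [_ /vlineP[d ->] zE]] zV].
  have E : z = (k + d * h p) *: w + d *: v p.
    by rewrite zE scalerDr scalerA scalerDl -addrA (addrC (_ *: w) (d *: v p)).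
  have k0 : k + d * h p = 0.
    by apply: wV0; rewrite -(addrK (d *: v p) (_ *: w)) -E rpredB ?rpredZ.
  by rewrite E k0 scale0r add0r rpredZ ?memv_line.
have f_inj : injective f.
  by move=> p q fpq; apply/x_inj/val_inj; rewrite (proj p).2 (proj q).2 fpq.
exists o, f; split => //.
have fE p N : on_line (f p) N = (v p + h p *: w \in val N) by rewrite memvE.
split => // S S3; split.
  case=> l Ll Sl; have [c [d hl]] := h_aff l Ll.
  (* The projective line of height [c + d * t]: its vector [(b + c *: w) + t p *: (e + d *: w)] is
     the lift of [p]. *)
  set N := (<[b + c *: w]> + <[e + d *: w]>)%VS.
  have N2 : \dim N == 2%N.
    rewrite eqn_leq; apply/andP; split.
      apply: leq_trans (dimv_add_leqif _ _).1 _.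
      by rewrite !dim_vline; do 2 case: (_ != 0).
    (* Adding [w] to [N] recovers the whole space, so [N] cannot have dimension below 2. *)
    have NV : (V <= N + <[w]>)%VS.
      have wN : w \in (N + <[w]>)%VS by rewrite (subvP (addvSr _ _)) ?memv_line.
      have bN : b + c *: w \in (N + <[w]>)%VS.
        by rewrite (subvP (addvSl _ _)) // (subvP (addvSl _ _)) ?memv_line.
      have eN : e + d *: w \in (N + <[w]>)%VS.
        by rewrite (subvP (addvSl _ _)) // (subvP (addvSr _ _)) ?memv_line.
      apply: subv_trans Vbe _; rewrite subv_add -!memvE.
      by rewrite -(rpredDr b (rpredZ c wN)) bN -(rpredDr e (rpredZ d wN)) eN.
    have := Vw _ NV; rewrite (subvP (addvSr _ _)) ?memv_line // => /(_ isT).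
    move/leq_trans/(_ (dimv_add_leqif _ _).1); rewrite dim_vline w0.
    by rewrite addn1 ltnS.
  exists (exist _ N N2) => p /(subsetP Sl) pl; rewrite fE /=.
  have -> : v p + h p *: w = (b + c *: w) + t p *: (e + d *: w).
    rewrite (hl p pl) scalerDl scalerDr scalerA (mulrC (t p)) addrACA.
    by [].
  by rewrite memv_add ?rpredZ ?memv_line.
case=> N SN; have N2 : \dim (val N) = 2%N by apply/eqP/(valP N).
have triple p q r : p \in S -> q \in S -> r \in S -> p != q -> p != r -> q != r ->
    exists2 l, l \in lines C & [/\ p \in l, q \in l & r \in l].
  move=> pS qS rS pq pr qr; apply: h_al => //; rewrite /aligned -subr_eq0.
  (* A nonzero determinant would put [w], then [e], then [b] in [N], which has only dimension 2. *)
  apply/negPn/negP => D0.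
  have mem z : z \in S -> v z + h z *: w \in val N.
    by move=> /SN; rewrite fE.
  have diff z : z \in S -> (t z - t p) *: e + (h z - h p) *: w \in val N.
    move=> zS; have := rpredB (mem _ zS) (mem _ pS).
    by rewrite /v opprD addrACA opprD (addrACA b) subrr add0r -!scalerBl.
  have wN : w \in val N.
    have := rpredB (rpredZ (t r - t p) (diff _ qS)) (rpredZ (t q - t p) (diff _ rS)).
    rewrite !scalerDr !scalerA opprD addrACA (mulrC (t r - t p)) subrr add0r -scalerBl.
    by rewrite (mulrC (t r - t p)) (mulrC (t q - t p)) rpredZeq (negPf D0).
  have eN : e \in val N.
    have := rpredB (diff _ qS) (rpredZ (h q - h p) wN); rewrite addrK.
    by rewrite rpredZeq subr_eq0 (inj_eq t_inj) eq_sym (negPf pq).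
  have bN : b \in val N.
    have := rpredB (rpredB (mem _ pS) (rpredZ (h p) wN)) (rpredZ (t p) eN).
    by rewrite addrK /v addrK.
  have := Vw (val N) _ wN; rewrite N2 => /(_ _)/negP; apply => //.
  by apply: subv_trans Vbe _; rewrite subv_add -!memvE bN.
have [p [q [r [[pS qS rS] [pq qr rp]]]]] : exists p q r,
    [/\ p \in S, q \in S & r \in S] /\ [/\ p != q, q != r & r != p].
  exact/card_gt2P.
have [l Ll [pl ql rl]] : exists2 l, l \in lines C & [/\ p \in l, q \in l & r \in l].
  by apply: triple => //; rewrite eq_sym.
exists l => //; apply/subsetP => s sS.
(* Any further point of [S] shares a line with [p] and [q], and by linearity that line is [l]. *)
have [->//|sp] := eqVneq s p; have [->//|sq] := eqVneq s q.
rewrite eq_sym in sp; rewrite eq_sym in sq.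
have [m Lm [pm qm sm]] := triple p q s pS qS sS pq sp sq.
by rewrite (C_linear.1 p q pq l m).
Qed.

End Projective.

Theorem lemma3p2 (R : realType) (C : configuration) :
  linear_config C -> forest_config C -> liftable (complex R) C.
Proof.
move=> C_linear C_forest; apply: liftable_of_heights => // t t_inj.
exact: exists_heights.
Qed.
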